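(* Let $k\ge1$ be an integer and let $H=(V,\mathcal I)$ be an interval hypergraph with $V=\{1,\dots,n\}$ such that at least one interval of $\mathcal I$ has at least $k$ points. Suppose that for any $I,J\in\mathcal I$ with $J\prec I$ and $I\cap J\ne\emptyset$ it holds that (a) $J\not\subseteq I$ and (b) $|I\setminus J|\ge k$. Then the algorithm $k$-COLOR$(\mathcal I)$, run with the value $c(k)=k$, produces a $k$-SCF coloring of $H$ using $k$ colors, which is optimal.
   Context: An interval hypergraph is $H=(V,\mathcal I)$ with $V=\{1,\dots,n\}$ and $\mathcal I\subseteq\{\{i,i+1,\dots,j\}\mid 1\le i\le j\le n\}$. A coloring $C:V\to\mathbb N$ is a $k$-strong conflict-free ($k$-SCF) coloring of $H$ if for every $e\in\mathcal I$: when $|e|\le k$ all points of $e$ have pairwise distinct colors; when $|e|>k$ there are at least $k$ colors each of which is assigned to exactly one point of $e$. Optimal means using the minimum possible number of colors among $k$-SCF colorings of $H$. Color $0$ is a default color meaning ''not colored'' (the output can be viewed as a partial coloring); only positive colors are counted. A color $c\ge1$ is unique in $I$ if exactly one point of $I$ currently has color $c$. An interval $I$ is $k$-colored if at least $\min\{|I|,k\}$ colors $c\ge1$ are unique in $I$. The output of the algorithm is $k$-SCF when every interval of $\mathcal I$ is $k$-colored at the end. For an interval $I$ let $\ell(I)=\min I$, $r(I)=\max I$. Order intervals by: $I\prec J$ iff $r(I)<r(J)$, or $r(I)=r(J)$ and $\ell(I)>\ell(J)$. Algorithm $k$-COLOR$(\mathcal I)$ with parameter $c(k)$: initially all points have color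 $0$; set $\mathcal I_1=\mathcal I$. For $t=1,2,\dots$, as long as $\mathcal I_t\neq\emptyset$, perform step $t$: (1) let $P_t=\{p_0<p_1<\dots<p_{n_t}\}$ be the set returned by SELECT$(\mathcal I_t)$; (2) for each $i=0,\dots,n_t$ assign (overwriting any previous color) to $p_i$ the color $(t-1)c(k)+(i \bmod c(k))+1$; (3) let $\mathcal X_t$ be the set of $I\in\mathcal I_t$ that are $k$-colored under the current coloring; (4) set $\mathcal I_{t+1}=\mathcal I_t\setminus\mathcal X_t$. SELECT$(\mathcal I_t)$: start with $P_t=\emptyset$; go through the intervals $I\in\mathcal I_t$ in increasing $\prec$ order; whenever $|I\cap P_t|<\min\{|I|,k\}$, add to $P_t$ the largest $\min\{|I|,k\}-|I\cap P_t|$ points of $I\setminus P_t$. Return $P_t$. *)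

(* Defs.v *)
From mathcomp Require Import all_boot.
Set Implicit Arguments.
Unset Strict Implicit.
Unset Printing Implicit Defensive.

(* The vertex set {1, .., n} is represented by 'I_n, the vertex p + 1 being
   the ordinal p; a hypergraph on it is its set of hyperedges. *)

Definition interval_hypergraph n (H : {set {set 'I_n}}) : Prop :=
  forall e, e \in H ->
  exists i j : 'I_n, i <= j /\ e = [set p : 'I_n | i <= p <= j].

Section IntervalHypergraphs.

Variable n : nat.
Implicit Types (I J P A : {set 'I_n}) (H : {set {set 'I_n}}).
Implicit Types (C : 'I_n -> nat) (c k m t : nat).

Definition lend I : nat := \big[minn/n]_(p in I) p.
Definition rend I : nat := \max_(p in I) p.

Definition prec I J : bool :=
  (rend I < rend J) || ((rend I == rend J) && (lend J < lend I)).

Definition unique_color C I c : bool := #|[set p in I | C p == c]| == 1.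

Definition unique_colors C I : seq nat :=
  [seq c <- undup [seq C p | p in I] | unique_color C I c].

(* Here every value of C, including 0, is a color. *)
Definition kSCF k H C : Prop :=
  forall e, e \in H ->
  (#|e| <= k -> {in e &, injective C}) /\
  (k < #|e| -> k <= size (unique_colors C e)).

Definition num_colors C : nat := size (undup (codom C)).

(* From here on, color 0 stands for "not colored" and is never counted. *)
Definition k_colored k C I : bool :=
  minn #|I| k <= size [seq c <- unique_colors C I | 0 < c].

Definition partial_kSCF k H C : Prop :=
  forall e, e \in H -> k_colored k C e.

Definition num_pos_colors C : nat :=
  size [seq c <- undup (codom C) | 0 < c].

(* The m largest points of A (all of A if #|A| <= m). *)
Definition largest m A : {set 'I_n} :=
  [set p in A | #|[set q in A | p < q]| < m].

Definition select_step k P I : {set 'I_n} :=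
  let d := minn #|I| k in
  if #|I :&: P| < d then P :|: largest (d - #|I :&: P|) (I :\: P) else P.

Definition select k H : {set 'I_n} :=
  foldl (select_step k) set0
    (sort (fun I J => (I == J) || prec I J) (enum H)).

(* The i such that p = p_i, when P = {p_0 < p_1 < ...} and p \in P. *)
Definition rank P (p : 'I_n) : nat := #|[set q in P | q < p]|.

Definition recolor c t P C : 'I_n -> nat :=
  fun p => if p \in P then t.-1 * c + rank P p %% c + 1 else C p.

(* color_loop k c t H C C': the loop, entered at step t with remaining
   intervals H and current coloring C, terminates with final coloring C'.
   The two rules are mutually exclusive, so C' is determined by the rest. *)
Inductive color_loop k c :
  nat -> {set {set 'I_n}} -> ('I_n -> nat) -> ('I_n -> nat) -> Prop :=
| color_loop_stop t C : color_loop k c t set0 C C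
| color_loop_step t H C C' :
    H != set0 ->
    let C1 := recolor c t (select k H) C in
    let X := [set I in H | k_colored k C1 I] in
    color_loop k c t.+1 (H :\: X) C1 C' ->
    color_loop k c t H C C'.

Definition k_color k c H C : Prop := color_loop k c 1 H (fun=> 0) C.

End IntervalHypergraphs.

(* Main.v *)
Require Import Defs.
From mathcomp Require Import all_boot.
From mathcomp Require Import zify.

(** Under (a) and (b), an interval I meeting an earlier interval J starts and
    ends after J, and I \ J is a final segment of I with at least k points.
    Hence the points SELECT adds for I avoid all earlier intervals, and the
    points already selected in I all lie in one earlier interval. Inductively
    SELECT picks exactly min(|I|, k) points of every I; these have consecutive
    ranks, so they get distinct colors mod k, and one step colors everything. *)

(** * Ranks in a finite linear order *)

Lemma perm_card_below {T : finType} {lt : rel T} (A : {set T}) :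
  transitive lt -> irreflexive lt ->
  (forall x y, [|| x == y, lt x y | lt y x]) ->
  perm_eq [seq #|[set q in A | lt q p]| | p <- enum A] (iota 0 #|A|).
Proof.
move=> lt_tr lt_irr lt_tot.
set f := fun p => #|[set q in A | lt q p]|.
(* Strict monotonicity makes [f] injective on [A]; its values lie below [#|A|], so by counting it
   takes each of them exactly once. *)
have f_mono p q : p \in A -> lt p q -> f p < f q.
  move=> pA pq; apply: proper_card; apply/properP; split.
    apply/subsetP => z; rewrite !inE => /andP[-> zp]; exact: lt_tr pq.
  by exists p; rewrite !inE ?pA ?pq ?lt_irr.
have f_uniq : uniq (map f (enum A)).
  rewrite map_inj_in_uniq ?enum_uniq // => p q.
  rewrite !mem_enum => pA qA fE.
  have [/eqP //|/(f_mono _ _ pA)|/(f_mono _ _ qA)] := or3P (lt_tot p q);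
    by rewrite fE ltnn.
have f_sub : {subset map f (enum A) <= iota 0 #|A|}.
  move=> y /mapP[p]; rewrite mem_enum => pA ->.
  rewrite mem_iota add0n /=; apply: proper_card; apply/properP; split.
    by apply/subsetP => z; rewrite inE => /andP[].
  by exists p; rewrite // inE lt_irr andbF.
have [|_ eq_mem] := uniq_min_size f_uniq f_sub; first by rewrite size_map size_iota -cardE.
exact: (uniq_perm f_uniq (iota_uniq _ _) eq_mem).
Qed.

Section Selection.
Set Implicit Arguments.
Unset Strict Implicit.

Variables n k : nat.
Implicit Types (I J P A : {set 'I_n}) (H : {set {set 'I_n}}).

(** Ranking by the reversed order, the points of [largest m A] are those of rank below [m], and the
    ranks run once through 0, ..., [#|A|] - 1. *)
Lemma card_largest m A : m <= #|A| -> #|largest m A| = m.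
Proof.
move=> m_le.
have gt_total (x y : 'I_n) : [|| x == y, y < x | x < y].
  by rewrite -val_eqE /=; lia.
have /permP/(_ (fun i => i < m)) := perm_card_below A
  (fun y x z (xy : y < x) (yz : z < y) => ltn_trans yz xy)
  (fun x => ltnn x) gt_total.
have -> : count (fun i => i < m) (iota 0 #|A|) = m.
  rewrite -(subnKC m_le) iotaD count_cat add0n.
  rewrite (_ : count _ (iota 0 m) = m); last first.
    rewrite -[RHS](size_iota 0); apply/eqP; rewrite -all_count.
    by apply/allP => i; rewrite mem_iota add0n.
  rewrite (_ : count _ _ = 0) ?addn0 //; apply/eqP.
  rewrite -leqn0 leqNgt -has_count; apply/hasPn => i.
  by rewrite mem_iota -leqNgt => /andP[].
move=> {2}<-; rewrite count_map -size_filter cardE.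
congr size; rewrite /enum_mem.
rewrite -filter_predI; apply: eq_filter => p.
by rewrite !inE andbC.
Qed.

Lemma rank_onto P i : i < #|P| -> exists2 p, p \in P & rank P p = i.
Proof.
move=> i_lt.
have lt_total (x y : 'I_n) : [|| x == y, x < y | y < x].
  by rewrite -val_eqE /=; lia.
have /perm_mem/(_ i) := perm_card_below P
  (fun (y x z : 'I_n) => @ltn_trans y x z) (fun x => ltnn x) lt_total.
rewrite mem_iota i_lt /= => /mapP[p]; rewrite mem_enum => pP ->.
by exists p.
Qed.

(** * Endpoints of intervals and the order of processing *)

Lemma bigmin_leq (s : seq 'I_n) I p :
  p \in s -> p \in I -> \big[minn/n]_(q <- s | q \in I) q <= p.
Proof.
elim: s => // q s IHs; rewrite inE big_cons => /orP[/eqP <- -> | ps pI].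
  exact: geq_minl.
by have := IHs ps pI; case: ifP => // _; lia.
Qed.

Lemma mem_ends H I p : interval_hypergraph H -> I \in H ->
  (p \in I) = (lend I <= p <= rend I).
Proof.
move=> hH /hH [i [j [ij IE]]].
have iI : i \in I by rewrite IE inE leqnn.
have jI : j \in I by rewrite IE inE leqnn ij.
have -> : lend I = i.
  apply/eqP; rewrite eqn_leq bigmin_leq ?mem_index_enum //=.
  (* The default value [n] of the minimum respects the bound because [i] is an ordinal below [n]. *)
  apply: (big_ind (leq i)) => [|x y|q]; first exact: ltnW.
    by lia.
  by rewrite IE inE => /andP[].
have -> : rend I = j.
  apply/eqP; rewrite eqn_leq (leq_bigmax_cond (F := @nat_of_ord n)) // andbT.
  by apply/bigmax_leqP => q; rewrite IE inE => /andP[].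
by rewrite IE inE.
Qed.

Definition preceq I J := (I == J) || prec I J.

Lemma preceq_trans : transitive preceq.
Proof.
rewrite /preceq => J I K /orP[/eqP -> //|IJ] /orP[/eqP <-|JK].
  by rewrite IJ orbT.
by apply/orP; right; move: IJ JK; rewrite /prec; lia.
Qed.

Lemma preceq_total H : interval_hypergraph H -> {in H &, total preceq}.
Proof.
move=> hH I J IH JH; rewrite /preceq /prec (eq_sym J).
have [//|/eqP I_neq_J] := boolP (I == J).
(* Only a tie at both ends could make two intervals incomparable, and the two ends determine a
   hyperedge. *)
suff : (lend I != lend J) || (rend I != rend J) by lia.
rewrite -negb_and; apply/negP => /andP[/eqP lE /eqP rE].
by apply: I_neq_J; apply/setP => p; rewrite !(mem_ends p hH) // lE rE.
Qed.

Lemma prec_meet_ends H I J : interval_hypergraph H -> I \in H -> J \in H ->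
  prec J I -> ~~ (J \subset I) -> lend J < lend I /\ rend J <= rend I.
Proof.
move=> hH IH JH JI JnI.
have rJI : rend J <= rend I by move: JI; rewrite /prec; lia.
split=> //; rewrite ltnNge; apply: contra JnI => lIJ.
by apply/subsetP => p; rewrite !(mem_ends p hH) //; lia.
Qed.

(** * SELECT meets every interval in the minimal number of points *)

Section Separated.

Variable H : {set {set 'I_n}}.
Hypothesis hH : interval_hypergraph H.
Hypothesis hab : forall I J, I \in H -> J \in H ->
  prec J I -> I :&: J != set0 -> ~~ (J \subset I) /\ k <= #|I :\: J|.

(** The invariant of SELECT once the intervals of [s] are processed. The first clause lets any
    selected point be traced back to an earlier interval. *)
Definition well_selected (s : seq {set 'I_n}) P :=
  (forall p, p \in P -> exists2 J, J \in s & p \in J) /\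
  (forall J, J \in s -> #|J :&: P| = minn #|J| k).

(** The earlier interval [J] holding the largest selected point of [I] starts before [I], so it
    holds all selected points of [I]; there are at most [k] of these, and [k <= #|I|] by (b). *)
Lemma card_selected_before s P I : {subset s <= H} -> I \in H ->
  {in s, forall J, prec J I} -> well_selected s P -> #|I :&: P| <= minn #|I| k.
Proof.
move=> sH IH sI [P_sub P_card].
have [-> | [x xIP]] := set_0Vmem (I :&: P); first by rewrite cards0.
case: (@arg_maxnP _ x (mem (I :&: P)) val xIP) => p.
rewrite /= inE => /andP[pI pP] p_max.
have [J Js pJ] := P_sub p pP.
have IJ : I :&: J != set0 by apply/set0Pn; exists p; rewrite inE pI.
have [JnI k_le] := hab IH (sH _ Js) (sI _ Js) IJ.
have [lJI _] := prec_meet_ends hH IH (sH _ Js) (sI _ Js) JnI.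
have k_le_I : k <= #|I| by apply: leq_trans k_le (subset_leq_card (subsetDl _ _)).
rewrite (minn_idPr k_le_I); apply: leq_trans (geq_minr #|J| k).
rewrite -(P_card _ Js); apply/subset_leq_card/subsetP => q qIP.
have := p_max q qIP; move: qIP pJ; rewrite !inE => /andP[qI ->].
move: qI; rewrite andbT !(mem_ends _ hH (sH _ Js)) (mem_ends _ hH IH) /=.
by lia.
Qed.

(** All of [I :\: J] lies to the right of a common point [x]. By (b), at least [k - #|I :&: P|] of
    these points are outside [P], so [x] has too many unselected points of [I] above it to be
    chosen. *)
Lemma largest_disjoint I J P : I \in H -> J \in H -> prec J I ->
  J :&: largest (minn #|I| k - #|I :&: P|) (I :\: P) = set0.
Proof.
move=> IH JH JI; apply/eqP/set0Pn => -[x].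
rewrite !inE => /andP[xJ /andP[/andP[xnP xI]]]; apply/negP; rewrite -leqNgt.
have IJ : I :&: J != set0 by apply/set0Pn; exists x; rewrite inE xI.
have [JnI k_le] := hab IH JH JI IJ.
have [lJI rJI] := prec_meet_ends hH IH JH JI JnI.
apply: (@leq_trans #|(I :\: J) :\: P|).
  have := cardsID P (I :\: J).
  have : #|(I :\: J) :&: P| <= #|I :&: P|.
    by apply/subset_leq_card/setSI/subsetDl.
  by lia.
apply/subset_leq_card/subsetP => y; rewrite !inE => /and3P[-> yJ yI].
rewrite yI; move: yJ yI xJ; rewrite !(mem_ends _ hH JH) (mem_ends _ hH IH).
by lia.
Qed.

Lemma well_selected_step s P I : {subset s <= H} -> I \in H ->
  {in s, forall J, prec J I} -> well_selected s P ->
  well_selected (rcons s I) (select_step k P I).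
Proof.
move=> sH IH sI sP; have IP_le := card_selected_before sH IH sI sP.
case: sP => P_sub P_card; rewrite /select_step.
set d := minn #|I| k in IP_le *.
set L := largest _ _.
have stay p : p \in P -> exists2 J, J \in rcons s I & p \in J.
  by move=> /P_sub[J Js pJ]; exists J; rewrite // mem_rcons inE Js orbT.
case: ltnP => [IP_lt | d_le]; split=> //.
- move=> p /setUP[/stay //|]; rewrite !inE => /andP[/andP[_ pI] _].
  by exists I; rewrite // mem_rcons inE eqxx.
- move=> J; rewrite mem_rcons inE => /orP[/eqP -> | Js]; rewrite setIUr.
    have LI : L \subset I :\: P by apply/subsetP => p; rewrite !inE => /andP[].
    have /setIidPr -> := subset_trans LI (subsetDl _ _).
    rewrite cardsU (_ : _ :&: L = set0) ?cards0 ?subn0; last first.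
      apply/setP => p; rewrite !inE; apply/negP => /andP[/andP[_ pP]].
      by rewrite pP.
    rewrite card_largest; first exact/subnKC/ltnW.
    by have := cardsID P I; rewrite /d; lia.
  by rewrite (largest_disjoint P IH (sH _ Js) (sI _ Js)) setU0 P_card.
(* Nothing is added here; the failed test and the bound [IP_le] together give equality. *)
- move=> J; rewrite mem_rcons inE => /orP[/eqP -> | /P_card //].
  by apply/eqP; rewrite eqn_leq IP_le.
Qed.

Lemma card_select : {in H, forall I, #|I :&: select k H| = minn #|I| k}.
Proof.
set s := sort preceq (enum H).
have sE : s =i H by move=> J; rewrite mem_sort mem_enum.
suff [_ cardP] : well_selected s (select k H) by move=> I; rewrite -sE => /cardP.
have s_uniq : uniq s by rewrite sort_uniq enum_uniq.
have : pairwise preceq s.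
  rewrite -(sorted_pairwise preceq_trans).
  apply: (sort_sorted_in (preceq_total hH)).
  by apply/allP => J; rewrite mem_enum.
have sH : {subset s <= H} by move=> J; rewrite sE.
have -> : select k H = foldl (select_step k) set0 s by [].
(* Induction from the right follows [foldl], which treats the last interval last. *)
elim/last_ind: s {sE} s_uniq sH => [|s I IHs] s_uniq sH.
  by split=> // p; rewrite inE.
rewrite pairwise_rcons foldl_rcons => /andP[sI s_sorted].
have sub_s : {subset s <= H}.
  by move=> J Js; apply: sH; rewrite mem_rcons inE Js orbT.
move: s_uniq; rewrite rcons_uniq => /andP[Is s_uniq].
apply: well_selected_step => //; last exact: IHs.
  by apply: sH; rewrite mem_rcons inE eqxx.
(* Sorting gives only [preceq]; it is strict because the list has no repetition. *)
move=> J Js; have /orP[/eqP JI|//] := allP sI J Js.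
by rewrite -JI Js in Is.
Qed.

End Separated.

(** * Ranks modulo [k] inside one interval *)

Lemma rank_split P (p q : 'I_n) : p <= q ->
  rank P q = rank P p + #|[set z in P | p <= z < q]|.
Proof.
move=> pq; rewrite /rank -cardsUI (_ : _ :&: _ = set0) ?cards0 ?addn0.
  by congr #|pred_of_set _|; apply/setP => z; rewrite !inE; case: (z \in P); lia.
by apply/setP => z; rewrite !inE; case: (z \in P); lia.
Qed.

Lemma rank_mod_inj H I P : interval_hypergraph H -> I \in H ->
  #|I :&: P| <= k -> {in I :&: P &, injective (fun p => rank P p %% k)}.
Proof.
move=> hH IH IP_le p q.
wlog pq : p q / p <= q.
  move=> wl pIP qIP E; have [/wl|/ltnW /wl] := leqP p q; first exact.
  by move/(_ qIP pIP (esym E)).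
rewrite !inE => /andP[pI pP] /andP[qI qP] /eqP E.
apply/eqP/negP => p_neq_q; move: E; rewrite (rank_split P pq) -{1}[rank P p]addn0.
rewrite eqn_modDl mod0n.
set D := [set _ in _ | _].
(* The rank difference [#|D|] is a multiple of [k]. As [D] lies in [I :&: P] and misses [q], it must
   be empty, yet it contains [p]. *)
have D_lt : #|D| < k.
  apply: leq_trans IP_le; apply: proper_card; apply/properP; split; last first.
    by exists q; rewrite !inE ?qI ?qP ?ltnn ?andbF.
  apply/subsetP => z; rewrite !inE => /andP[-> /andP[pz zq]]; rewrite andbT.
  by move: pI qI; rewrite !(mem_ends _ hH IH); lia.
rewrite modn_small // eq_sym cards_eq0 => /eqP/setP/(_ p).
by rewrite !inE pP leqnn /= ltn_neqAle pq andbT => /negbFE.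
Qed.

(** * Unique colors, the strong conflict-free property and color counts *)

Lemma k_colored_of_inj C I (P : {set 'I_n}) : P \subset I ->
  minn #|I| k <= #|P| -> {in P, forall p, 0 < C p} ->
  {in P & I, forall p q, C p = C q -> p = q} -> k_colored k C I.
Proof.
move=> PI k_le C_gt0 C_inj; apply: leq_trans k_le _.
rewrite cardE -(size_map C); apply: uniq_leq_size.
  rewrite map_inj_in_uniq ?enum_uniq // => p q; rewrite !mem_enum => pP qP.
  by apply: C_inj => //; apply: (subsetP PI).
move=> c /mapP[p]; rewrite mem_enum => pP ->.
have pI := subsetP PI p pP.
rewrite !mem_filter C_gt0 //= mem_undup; apply/andP; split; last exact: image_f.
(* [C_inj] compares [p] with every point of [I], not only of [P], so its color is unique in all of
   [I]. *)
apply/cards1P; exists p; apply/setP => q; rewrite !inE.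
apply/andP/eqP => [[qI /eqP Cqp] | -> //]; exact/esym/C_inj.
Qed.

Lemma unique_colors_codom C I : {subset unique_colors C I <= codom C}.
Proof.
move=> c; rewrite mem_filter mem_undup => /andP[_ /imageP[p _ ->]].
exact: codom_f.
Qed.

Lemma unique_colors_uniq C I : uniq (unique_colors C I).
Proof. exact/filter_uniq/undup_uniq. Qed.

Lemma k_colored_kSCF H C : partial_kSCF k H C -> kSCF k H C.
Proof.
move=> HC e /HC; rewrite /k_colored size_filter => e_le.
have {}e_le := leq_trans e_le (count_size _ _).
split=> e_k; last by lia.
(* For [#|e| <= k] there are at least [#|e|] unique colors, so the list of the [#|e|] colors on [e]
   has no repetition. *)
apply/dinjectiveP/(leq_size_uniq (unique_colors_uniq C e)).
  by move=> c; rewrite mem_filter mem_undup => /andP[].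
by rewrite size_image; move/minn_idPl: e_k e_le => ->.
Qed.

Lemma num_pos_colors_ge C I : k <= #|I| -> k_colored k C I ->
  k <= num_pos_colors C.
Proof.
move=> /minn_idPr kI; rewrite /k_colored kI => /leq_trans; apply.
apply: uniq_leq_size => [|c]; first exact/filter_uniq/unique_colors_uniq.
rewrite mem_filter => /andP[c_gt0 /unique_colors_codom cC].
by rewrite mem_filter c_gt0 mem_undup.
Qed.

Lemma num_colors_ge H C I : I \in H -> k <= #|I| -> kSCF k H C ->
  k <= num_colors C.
Proof.
move=> IH kI HC; have [small big] := HC I IH.
have [/small C_inj|/big] := leqP #|I| k.
  apply: leq_trans kI _; rewrite cardE -(size_map C); apply: uniq_leq_size.
    rewrite map_inj_in_uniq ?enum_uniq // => p q; rewrite !mem_enum.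
    exact: C_inj.
  by move=> c /mapP[p _ ->]; rewrite mem_undup codom_f.
move=> /leq_trans; apply; apply: uniq_leq_size => [|c].
  exact: unique_colors_uniq.
by rewrite mem_undup; apply: unique_colors_codom.
Qed.

Lemma num_pos_colors_rank P : 0 < k -> k <= #|P| ->
  num_pos_colors (recolor k 1 P (fun=> 0)) = k.
Proof.
move=> k_gt0 kP; rewrite -[RHS](size_iota 1); apply/perm_size/uniq_perm.
- exact/filter_uniq/undup_uniq.
- exact: iota_uniq.
move=> c; rewrite mem_filter mem_undup mem_iota add1n.
apply/andP/andP => [[c_gt0 /codomP[p cE]] | [c_gt0 c_le]].
  move: c_gt0; rewrite cE /recolor mul0n; case: ifP => // _ _.
  by have := ltn_pmod (rank P p) k_gt0; lia.
(* Ranks start at 0 and colors at 1, so color [c] is found at rank [c.-1], which occurs because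
   [k <= #|P|]. *)
split=> //; have [|p pP pE] := @rank_onto P c.-1; first by lia.
apply/codomP; exists p; rewrite /recolor pP pE modn_small; lia.
Qed.

End Selection.

(** * The algorithm stops after one step, with an optimal coloring *)

Theorem theorem5 (k n : nat) (H : {set {set 'I_n}}) (hk : 1 <= k)
    (hH : interval_hypergraph H)
    (hbig : exists2 I : {set 'I_n}, I \in H & k <= #|I|)
    (hab : forall I J : {set 'I_n}, I \in H -> J \in H ->
       prec J I -> I :&: J != set0 ->
       ~~ (J \subset I) /\ k <= #|I :\: J|) :
  exists C : 'I_n -> nat,
    k_color k k H C /\
    partial_kSCF k H C /\
    kSCF k H C /\
    num_pos_colors C = k /\
    (forall C' : 'I_n -> nat,
       partial_kSCF k H C' -> num_pos_colors C <= num_pos_colors C') /\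
    (forall C' : 'I_n -> nat,
       kSCF k H C' -> num_pos_colors C <= num_colors C').
Proof.
have [I0 I0H kI0] := hbig.
have cardP := card_select hH hab.
set P := select k H in cardP.
set C := recolor k 1 P (fun=> 0).
have C_partial : partial_kSCF k H C.
  move=> I IH; apply: (@k_colored_of_inj _ _ _ _ (I :&: P)).
  - exact: subsetIl.
  - by rewrite cardP.
  - by move=> p /setIP[_ pP]; rewrite /C /recolor pP; lia.
  move=> p q pIP qI; have /setIP[pI pP] := pIP.
  (* A point outside [P] keeps color 0, which differs from the positive color of [p]. *)
  rewrite /C /recolor pP mul0n; case: ifP => [qP E | _]; last by lia.
  have IP_le : #|I :&: P| <= k by rewrite cardP // geq_minr.
  have qIP : q \in I :&: P by rewrite inE qI.
  by apply: (rank_mod_inj hH IH IP_le pIP qIP) => /=; lia.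
have C_num : num_pos_colors C = k.
  apply: num_pos_colors_rank => //; apply: leq_trans (subset_leq_card (subsetIr I0 P)).
  by rewrite cardP // leq_min kI0 leqnn.
exists C; rewrite C_num; split; [|split; [|split; [|split; [|split]]]] => //.
- apply: color_loop_step; first by apply/set0Pn; exists I0.
  (* Every interval is [k]-colored after step 1, so none remains for step 2. *)
  rewrite -/P -/C (_ : _ :\: _ = set0); first exact: color_loop_stop.
  apply/setP => I; rewrite !inE.
  by case: (boolP (I \in H)) => [/C_partial -> | _]; rewrite ?andbF.
- exact: k_colored_kSCF.
- by move=> C' /(_ _ I0H); apply: num_pos_colors_ge.
- by move=> C'; apply: num_colors_ge I0H kI0.
Qed.
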